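(* Let $(x_i,y_i)_{i=1}^n$ be training data with $x_i\in\mathbb{R}^d$, $\|x_i\|\le1$, $y_i\in\{-1,1\}$. Let $f_\theta$ be a $K$-layer neural network whose activation $\sigma$ is $H$-positively homogeneous and satisfies $\|\sigma(v)\|\le\|v\|^H$ for all $v$, and assume $K\ge2$, $H\ge1$. Let $L(\theta)=\frac1n\sum_{i=1}^n\ell(y_if_\theta(x_i))$ with logistic loss $\ell(z)=\ln(1+e^{-z})$ and $L_\lambda(\theta)=L(\theta)+\frac\lambda2\|\theta\|_2^2$. Let $\lambda>0$ and let $\theta$ be a non-zero stationary point of $L_\lambda$. Assume that $L_\lambda(\theta)\le L_\lambda(\theta_0)$ for some fixed parameter vector $\theta_0$ and that $L(\theta_0)\ge1$. Then, with $Z=\sum_{k=1}^KH^{K-k}$, $$\sum_{k=1}^K\frac{(H^{K-k})^{3/2}}{Z}\cdot\frac{\|W_k\|_2}{\|W_k\|_F}\;\ge\;\sqrt{\frac{\lambda}{L(\theta_0)+\lambda\|\theta_0\|^2}}.$$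
   Context: Network: $f_\theta(x)=\langle w_K,h_{K-1}\rangle$, $h_k=\sigma(W_kh_{k-1})$ for $k\in\{1,\dots,K-1\}$, $h_0=x$, where $W_1\in\mathbb{R}^{m\times d}$, $W_k\in\mathbb{R}^{m\times m}$ for $2\le k\le K-1$, $w_K\in\mathbb{R}^m$, and $W_K:=w_K^\top$; $\theta=(\mathrm{vec}(W_1),\dots,\mathrm{vec}(W_K))$; $\sigma:\mathbb{R}^m\to\mathbb{R}^m$. $H$-positively homogeneous: $\sigma(\alpha v)=\alpha^H\sigma(v)$ for all $\alpha\ge0$ and all $v$. $\|\cdot\|_2$ is the spectral norm and $\|\cdot\|_F$ the Frobenius norm of a matrix. Stationary point of $L_\lambda$: $\lambda\theta=-\nabla L(\theta)$; in the non-smooth case, $\lambda\theta=-g$ for some $g\in\partial L(\theta)$, where for a locally Lipschitz $F$, $\partial F(\theta)=\mathrm{conv}\{g:\exists\,\theta_j\to\theta,\ \nabla F(\theta_j)\to g\}$ is the Clarke differential. Standing assumptions: $f_\theta(x)$ is locally Lipschitz in $\theta$, and the chain rule holds, i.e. $\frac{d}{dt}F(\theta(t))=\langle g,\dot\theta(t)\rangle$ for all $g\in\partial F(\theta(t))$. *)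

(* Defs.v *)
From mathcomp Require Import all_boot all_order all_algebra.
From mathcomp Require Import all_classical all_reals all_analysis.

Set Implicit Arguments.
Unset Strict Implicit.
Unset Printing Implicit Defensive.

Import Order.TTheory GRing.Theory Num.Theory.
Import numFieldNormedType.Exports.

Local Open Scope classical_set_scope.
Local Open Scope ring_scope.

(* The library norm on matrices is the max norm, hence the definitions below.
   On row and column vectors [fdot] and [fnorm] are the Euclidean inner product
   and the Euclidean norm. *)
Definition fdot {R : realType} {p q : nat} (A B : 'M[R]_(p, q)) : R :=
  \sum_i \sum_j A i j * B i j.

Definition fnorm {R : realType} {p q : nat} (A : 'M[R]_(p, q)) : R :=
  Num.sqrt (fdot A A).

Definition spectral_norm {R : realType} {p q : nat} (A : 'M[R]_(p, q)) : R :=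
  sup [set fnorm (A *m v) | v in [set v : 'cV[R]_q | fnorm v <= 1]].

Definition is_gradient {R : realType} {N : nat} (F : 'rV[R]_N -> R)
    (theta g : 'rV[R]_N) : Prop :=
  is_diff theta F (fdot g).

(* Since the sequence [u] may be constant, [clarke F theta] contains the
   gradient of [F] at [theta] whenever it exists. *)
Definition clarke {R : realType} {N : nat} (F : 'rV[R]_N -> R)
    (theta : 'rV[R]_N) : set 'rV[R]_N :=
  smallest (@convex_set R 'rV[R]_N)
    [set g | exists u v : nat -> 'rV[R]_N,
      [/\ u @ \oo --> theta,
          forall j, is_gradient F (u j) (v j) &
          v @ \oo --> g]].

(* Local absolute continuity: the usual definition on every compact interval. *)
Definition is_arc {R : realType} {N : nat} (gamma : R -> 'rV[R]_N) : Prop :=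
  forall a b eps : R, 0 < eps -> exists2 delta : R, 0 < delta &
    forall (n : nat) (s t : 'I_n -> R),
      (forall i, [/\ a <= s i, s i <= t i & t i <= b]) ->
      trivIset setT (fun i => [set` `]s i, t i[]) ->
      \sum_i (t i - s i) < delta ->
      \sum_i fnorm (gamma (t i) - gamma (s i)) < eps.

(* The equality is required for almost every time only: imposed at every time
   and along all curves it would force [F] to be differentiable. *)
Definition chain_rule {R : realType} {N : nat} (F : 'rV[R]_N -> R) : Prop :=
  forall gamma : R -> 'rV[R]_N, is_arc gamma ->
    {ae (@lebesgue_measure R), forall t : R,
      forall v g : 'rV[R]_N,
        is_derive t (1 : R) gamma v -> clarke F (gamma t) g ->
        is_derive t (1 : R) (F \o gamma) (fdot g v)}.

Definition locally_lipschitz {R : realType} {N : nat}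
    (F : 'rV[R]_N -> R) : Prop :=
  forall theta : 'rV[R]_N,
    exists2 U, nbhs theta U & [lipschitz F t | t in U].

Definition pos_homogeneous {R : realType} {m : nat} (H : R)
    (sigma : 'cV[R]_m -> 'cV[R]_m) : Prop :=
  forall (alpha : R) (v : 'cV[R]_m), 0 <= alpha ->
    sigma (alpha *: v) = (alpha `^ H) *: sigma v.

(* Dimension of h_k for k < K. *)
Definition width (d m k : nat) : nat := if k is 0 then d else m.

(* Number of parameters: the blocks W_1, ..., W_(K-1), then w_K, whose length
   [width d m K.-1] is m for K >= 2. *)
Definition nparams (K d m : nat) : nat :=
  (\sum_(k < K.-1) m * width d m k + width d m K.-1)%N.

Section Network.
Context {R : realType} {K d m : nat}.
Implicit Types theta : 'rV[R]_(nparams K d m).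

(* W_k, meaningful for 1 <= k < K. The blocks are vectorized row by row. *)
Definition W theta (k : nat) : 'M[R]_(m, width d m k.-1) :=
  if @idP (k.-1 < K.-1)%N is ReflectT hk then
    vec_mx (submxrow (q_ := fun i : 'I_K.-1 => (m * width d m i)%N)
              (lsubmx theta) (Ordinal hk))
  else 0.

Definition w_last theta : 'cV[R]_(width d m K.-1) := (rsubmx theta)^T.

(* [phi W_k], with W_K = w_K^T. *)
Definition on_layer {T : Type} (phi : forall p q : nat, 'M[R]_(p, q) -> T)
    theta (k : nat) : T :=
  if (k < K)%N then phi _ _ (W theta k) else phi _ _ (w_last theta)^T.

Fixpoint hidden (sigma : 'cV[R]_m -> 'cV[R]_m) theta (x : 'cV[R]_d) (k : nat) :
    'cV[R]_(width d m k) :=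
  if k is k'.+1 then sigma (W theta k'.+1 *m hidden sigma theta x k') else x.

Definition network (sigma : 'cV[R]_m -> 'cV[R]_m) (x : 'cV[R]_d) theta : R :=
  fdot (w_last theta) (hidden sigma theta x K.-1).

Definition logistic (z : R) : R := ln (1 + expR (- z)).

Definition loss (sigma : 'cV[R]_m -> 'cV[R]_m) (n : nat)
    (x : 'I_n -> 'cV[R]_d) (y : 'I_n -> R) theta : R :=
  n%:R^-1 * \sum_i logistic (y i * network sigma (x i) theta).

End Network.

Definition regularized {R : realType} {N : nat} (lambda : R)
    (L : 'rV[R]_N -> R) (theta : 'rV[R]_N) : R :=
  L theta + lambda / 2 * fnorm theta ^+ 2.

(* Stationarity of [regularized lambda L], expressed through L. *)
Definition stationary {R : realType} {N : nat} (lambda : R)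
    (L : 'rV[R]_N -> R) (theta : 'rV[R]_N) : Prop :=
  exists2 g : 'rV[R]_N, clarke L theta g & lambda *: theta = - g.

(* Main.v *)
Require Import Defs.
From mathcomp Require Import all_boot all_order all_algebra.
From mathcomp Require Import all_classical all_reals all_analysis.
From mathcomp Require Import ring lra.
Import Order.TTheory GRing.Theory Num.Theory.
Import numFieldNormedType.Exports.
Local Open Scope classical_set_scope.
Local Open Scope ring_scope.

(* Write p_k = H^(K-k). The network is positively homogeneous of degree p_k in
   the block W_k, so at a point u where L is differentiable the directional
   derivative of L along the block W_k of u is -p_k S(u), where S(u) is the mean
   of z_i / (1 + e^(z_i)) over the margins z_i = y_i f_u(x_i). Since S is
   continuous, this identity survives limits and convex combinations, hence it
   holds for every Clarke subgradient. Stationarity then gives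
   lambda |W_k|_F^2 = p_k S for every k. Weighted AM-GM with the weights p_k / Z
   bounds the left-hand side of the claim from below by
   (lambda P^(2/Z) / S)^(1/2), where P is the product of the |W_k|_2^(p_k), and
   it remains to see S <= P^(2/Z) (L(theta0) + lambda |theta0|^2). If P >= 1,
   this follows from Z >= 2 and L_lambda(theta) <= L_lambda(theta0); if P < 1,
   from S <= max_i |f_theta(x_i)| <= P <= P^(2/Z) and L(theta0) >= 1. *)

(** * Frobenius inner product, Frobenius norm and spectral norm *)

Section Frobenius.
Context {R : realType}.

Lemma fdot_row N (u v : 'rV[R]_N) : fdot u v = \sum_j u 0 j * v 0 j.
Proof. by rewrite /fdot big_ord1. Qed.

Lemma fdot_ge0 p q (A : 'M[R]_(p, q)) : 0 <= fdot A A.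
Proof.
by apply: sumr_ge0 => i _; apply: sumr_ge0 => j _; rewrite -expr2 sqr_ge0.
Qed.

Lemma sqr_fnorm p q (A : 'M[R]_(p, q)) : fnorm A ^+ 2 = fdot A A.
Proof. by rewrite sqr_sqrtr ?fdot_ge0. Qed.

Lemma fnorm_ge0 p q (A : 'M[R]_(p, q)) : 0 <= fnorm A.
Proof. exact: sqrtr_ge0. Qed.

Lemma fnorm_eq0 p q (A : 'M[R]_(p, q)) : (fnorm A == 0) = (A == 0).
Proof.
rewrite -sqrf_eq0 sqr_fnorm /fdot pair_big /= psumr_eq0; last first.
  by move=> ij _; rewrite -expr2 sqr_ge0.
apply/allP/eqP => [A0|-> ij _]; last by rewrite mxE mul0r eqxx.
apply/matrixP => i j; have := A0 (i, j) (mem_index_enum _).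
by rewrite mxE -expr2 sqrf_eq0 => /eqP.
Qed.

Lemma fnorm_gt0 p q (A : 'M[R]_(p, q)) : (0 < fnorm A) = (A != 0).
Proof. by rewrite lt_neqAle fnorm_ge0 andbT eq_sym fnorm_eq0. Qed.

Lemma fnorm0 p q : fnorm (0 : 'M[R]_(p, q)) = 0.
Proof. by apply/eqP; rewrite fnorm_eq0. Qed.

Lemma fdotDl p q (A B C : 'M[R]_(p, q)) : fdot (A + B) C = fdot A C + fdot B C.
Proof.
rewrite /fdot -big_split; apply: eq_bigr => i _; rewrite -big_split.
by apply: eq_bigr => j _; rewrite mxE mulrDl.
Qed.

Lemma fdotZl p q a (A B : 'M[R]_(p, q)) : fdot (a *: A) B = a * fdot A B.
Proof.
rewrite /fdot mulr_sumr; apply: eq_bigr => i _; rewrite mulr_sumr.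
by apply: eq_bigr => j _; rewrite mxE mulrA.
Qed.

Lemma fdotC p q (A B : 'M[R]_(p, q)) : fdot A B = fdot B A.
Proof. by apply: eq_bigr => i _; apply: eq_bigr => j _; rewrite mulrC. Qed.

Lemma fnormZ p q a (A : 'M[R]_(p, q)) : fnorm (a *: A) = `|a| * fnorm A.
Proof.
by rewrite /fnorm fdotZl fdotC fdotZl mulrA -expr2 sqrtrM ?sqr_ge0 ?sqrtr_sqr.
Qed.

Lemma fnorm_tr p q (A : 'M[R]_(p, q)) : fnorm A^T = fnorm A.
Proof.
congr Num.sqrt; rewrite /fdot exchange_big.
by apply: eq_bigr => i _; apply: eq_bigr => j _; rewrite mxE.
Qed.

(** For [B != 0], the component of [A] orthogonal to [B] has nonnegative squared norm; multiplying
    by [fdot B B] gives the claim. *)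
Lemma fdot_CauchySchwarz p q (A B : 'M[R]_(p, q)) :
  fdot A B ^+ 2 <= fdot A A * fdot B B.
Proof.
have [->|B0] := eqVneq B 0.
  by rewrite fdotC -(scale0r 0) !fdotZl !mul0r mulr0 expr0n.
have bb0 : 0 < fdot B B.
  by rewrite -sqr_fnorm exprn_gt0// fnorm_gt0.
have := fdot_ge0 _ _ (A + (- (fdot A B / fdot B B)) *: B).
rewrite fdotDl fdotZl ![fdot _ (A + _)]fdotC !fdotDl !fdotZl (fdotC _ _ B A).
have -> : fdot A A + - (fdot A B / fdot B B) * fdot A B +
  - (fdot A B / fdot B B) * (fdot A B + - (fdot A B / fdot B B) * fdot B B) =
  (fdot A A * fdot B B - fdot A B ^+ 2) / fdot B B by field; rewrite gt_eqF.
by rewrite pmulr_lge0 ?invr_gt0// subr_ge0.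
Qed.

(** Cauchy-Schwarz for each row of [A] against each column of [B], summed over all entries of the
    product. *)
Lemma fnorm_mulmx p q r (A : 'M[R]_(p, q)) (B : 'M[R]_(q, r)) :
  fnorm (A *m B) <= fnorm A * fnorm B.
Proof.
rewrite -ler_sqr ?nnegrE ?mulr_ge0 ?fnorm_ge0// exprMn !sqr_fnorm.
rewrite [fdot B B]exchange_big /= /fdot mulr_suml.
apply: ler_sum => i _; rewrite mulr_sumr; apply: ler_sum => k _.
have := fdot_CauchySchwarz _ _ (row i A) (col k B)^T.
rewrite !fdot_row -expr2 mxE.
by congr (_ ^+ 2 <= _ * _); apply: eq_bigr => j _; rewrite !mxE.
Qed.

Lemma spectral_bound p q (A : 'M[R]_(p, q)) (v : 'cV[R]_q) :
  fnorm (A *m v) <= spectral_norm A * fnorm v.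
Proof.
have [->|v0] := eqVneq v 0.
  by rewrite mulmx0 !fnorm0 mulr0.
have nv0 : 0 < fnorm v by rewrite fnorm_gt0.
rewrite -ler_pdivrMr//.
(* The Frobenius norm of [A] bounds the set, so its [sup] is a genuine supremum; the witness is [v]
   normalized. *)
apply: ub_le_sup.
  exists (fnorm A) => _ [w /= w1 <-].
  apply: le_trans (fnorm_mulmx _ _ _ _ _) _.
  by rewrite ler_piMr ?fnorm_ge0.
exists ((fnorm v)^-1 *: v) => /=.
  by rewrite fnormZ ger0_norm ?invr_ge0 ?fnorm_ge0// mulVf ?gt_eqF.
by rewrite -scalemxAr fnormZ ger0_norm ?invr_ge0 ?fnorm_ge0// mulrC.
Qed.

Lemma spectral_norm_ge0 p q (A : 'M[R]_(p, q)) : 0 <= spectral_norm A.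
Proof.
apply: ub_le_sup.
  exists (fnorm A) => _ [w /= w1 <-].
  by apply: le_trans (fnorm_mulmx _ _ _ _ _) _; rewrite ler_piMr ?fnorm_ge0.
by exists 0; rewrite /= ?mulmx0 fnorm0 ?ler01.
Qed.

(** If the spectral norm vanished, [A] would kill every basis vector, so all its columns would be
    0. *)
Lemma spectral_norm_gt0 p q (A : 'M[R]_(p, q)) : A != 0 -> 0 < spectral_norm A.
Proof.
rewrite lt_neqAle spectral_norm_ge0 andbT; apply: contraNneq => A0.
apply/eqP/matrixP => i j; rewrite mxE.
have := spectral_bound _ _ A (delta_mx j 0); rewrite -A0 mul0r.
rewrite le_eqVlt ltNge fnorm_ge0 orbF fnorm_eq0 -colE => /eqP/colP/(_ i).
by rewrite !mxE.
Qed.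

Lemma fdot_row_mx a b (u u' : 'rV[R]_a) (v v' : 'rV[R]_b) :
  fdot (row_mx u v) (row_mx u' v') = fdot u u' + fdot v v'.
Proof.
rewrite !fdot_row big_split_ord /=; congr (_ + _); apply: eq_bigr => i _.
  by rewrite !row_mxEl.
by rewrite !row_mxEr.
Qed.

Lemma fdot_mxrow a (q : 'I_a -> nat) (u v : forall i, 'rV[R]_(q i)) :
  fdot (\mxrow_i u i) (\mxrow_i v i) = \sum_i fdot (u i) (v i).
Proof.
transitivity (\sum_i \sum_j u i 0 j * v i 0 j); last first.
  by apply: eq_bigr => i _; rewrite fdot_row.
rewrite [LHS]fdot_row [RHS]sig_big_dep /= (reindex _ tagnat.sig_bij_on) /=.
by apply: eq_bigr => k _; rewrite !mxE.
Qed.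

Lemma fdot_vec_mx p q (u v : 'rV[R]_(p * q)) :
  fdot (vec_mx u) (vec_mx v) = fdot u v.
Proof.
rewrite fdot_row (reindex _ (curry_mxvec_bij _ _)) /= /fdot pair_big /=.
by apply: eq_bigr => [[i j]] _; rewrite !mxE.
Qed.
End Frobenius.

(** * Rescaling of the parameters, layer by layer *)

Section Rescale.
Context {R : realType} {K d m : nat}.
Implicit Types theta : 'rV[R]_(nparams K d m).

(* The weight [c k] sits at every coordinate of the block W_k. *)
Definition layer_weights (c : nat -> R) : 'rV[R]_(nparams K d m) :=
  row_mx (\mxrow_(i < K.-1) const_mx (c i.+1)) (const_mx (c K)).

Definition rescale c theta : 'rV[R]_(nparams K d m) :=
  \row_j (layer_weights c 0 j * theta 0 j).

Definition block theta (i : 'I_K.-1) : 'rV[R]_(m * width d m i) :=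
  submxrow (q_ := fun i : 'I_K.-1 => (m * width d m i)%N) (lsubmx theta) i.

Lemma W_block theta (i : 'I_K.-1) : W theta i.+1 = vec_mx (block theta i).
Proof.
case: i => k hk; rewrite /W /=.
(* The match on [idP] is generalized to an arbitrary [reflect] proof, which can be split into
   cases. *)
have aux : forall (P : Prop) b (r : reflect P b)
    (f : P -> 'M[R]_(m, width d m k)) M,
  P -> (forall p, f p = M) -> (if r is ReflectT p then f p else 0) = M.
  by move=> P b [].
by apply: aux => // p; rewrite (bool_irrelevance p hk).
Qed.

Lemma W_out theta k : (K.-1 <= k)%N -> W theta k.+1 = 0.
Proof.
move=> hk; rewrite /W /=.
have aux : forall (P : Prop) b (r : reflect P b)
    (f : P -> 'M[R]_(m, width d m k)),
  ~ P -> (if r is ReflectT p then f p else 0) = 0.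
  by move=> P b [].
by apply: aux; apply/negP; rewrite -leqNgt.
Qed.

Lemma W_rescale c theta k : (0 < k)%N ->
  W (rescale c theta) k = c k *: W theta k.
Proof.
case: k => // k _.
have [hk|hk] := ltnP k K.-1; last by rewrite !W_out// scaler0.
rewrite !(W_block _ (Ordinal hk)).
apply/matrixP => i j; rewrite /block !mxE.
congr (_ * _).
by rewrite (unsplitK (inl _)) !mxE tagnat.Rank1K.
Qed.

Lemma w_last_rescale c theta :
  w_last (rescale c theta) = c K *: w_last theta.
Proof.
by apply/colP => i; rewrite !mxE (unsplitK (inr _)) mxE.
Qed.

Lemma rescaleE c theta :
  rescale c theta = row_mx
    (\mxrow_(i < K.-1) (c i.+1 *: block theta i))
    (c K *: rsubmx theta).
Proof.
rewrite -[LHS]hsubmxK; congr row_mx; apply/rowP => j; rewrite /block !mxE.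
  by rewrite (unsplitK (inl _)) !mxE tagnat.sig2K.
by rewrite (unsplitK (inr _)) !mxE.
Qed.

(** The blocks are pairwise orthogonal. Constant weights 1 recover the norm of [theta], and the
    weights [only_layer k] isolate that of one block. *)
Lemma fdot_rescale c theta : (0 < K)%N ->
  fdot theta (rescale c theta) =
  \sum_(1 <= k < K.+1) c k * on_layer (@fnorm R) theta k ^+ 2.
Proof.
move=> K0.
rewrite fdotC rescaleE -[X in fdot _ X]hsubmxK.
rewrite -[lsubmx theta in X in fdot _ X]submxrowK.
rewrite fdot_row_mx fdot_mxrow fdotZl.
rewrite big_nat_recr//= [on_layer _ _ K]/on_layer ltnn fnorm_tr sqr_fnorm.
congr (_ + _ * _); last by rewrite -sqr_fnorm -fnorm_tr sqr_fnorm.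
rewrite big_add1 /= big_mkord; apply: eq_bigr => i _.
have iK : (i.+1 < K)%N by rewrite -ltn_predRL.
by rewrite /on_layer iK fdotZl sqr_fnorm W_block fdot_vec_mx.
Qed.

(** The layer [l] of coordinate [j] is chosen before [c], so an identity relating several rescalings
    reduces to scalars. *)
Lemma layer_weightsE (j : 'I_(nparams K d m)) :
  exists l, forall c : nat -> R, layer_weights c 0 j = c l.
Proof.
case: (fintype.splitP (j : 'I_(_ + _))) => i ji.
  exists (tagnat.sig1 i).+1 => c.
  have -> : j = lshift _ i by exact: val_inj.
  by rewrite mxE (unsplitK (inl _)) !mxE.
exists K => c.
have -> : j = rshift _ i by exact: val_inj.
by rewrite mxE (unsplitK (inr _)) !mxE.
Qed.

Lemma rescale_coord (j : 'I_(nparams K d m)) :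
  exists l, forall c theta, rescale c theta 0 j = c l * theta 0 j.
Proof.
by have [l lE] := layer_weightsE j; exists l => c theta; rewrite mxE lE.
Qed.

Lemma rescale1 theta : rescale (fun=> 1) theta = theta.
Proof.
by apply/rowP => j; have [l lE] := rescale_coord j; rewrite lE mul1r.
Qed.

Definition at_layer (k : nat) (s : R) (j : nat) : R := if j == k then s else 1.

Definition only_layer (k j : nat) : R := (j == k)%:R.

(** Scaling one block by [1 + t] is a motion along a line, which turns homogeneity into a statement
    about directional derivatives. *)
Lemma rescale_at_layer k t theta :
  rescale (at_layer k (1 + t)) theta =
  t *: rescale (only_layer k) theta + theta.
Proof.
apply/rowP => j; have [l lE] := rescale_coord j.
have -> : (t *: rescale (only_layer k) theta + theta) 0 j =
  t * rescale (only_layer k) theta 0 j + theta 0 j by rewrite !mxE.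
rewrite !lE /at_layer /only_layer.
by case: eqP => _; rewrite ?mul1r ?mul0r ?mulr0 ?add0r// mulrDl mul1r addrC.
Qed.

End Rescale.

(** * Homogeneity of the network in one layer, and its bound by spectral norms *)

Section Network.
Context {R : realType} {K d m : nat} (H : R) (sigma : 'cV[R]_m -> 'cV[R]_m).
Implicit Types theta : 'rV[R]_(nparams K d m).
Context (K_gt0 : (0 < K)%N) (H_ge0 : 0 <= H).
Context (sigma_hom : pos_homogeneous H sigma).
Context (sigma_le : forall v, fnorm (sigma v) <= fnorm v `^ H).

(** The factor [s] enters at layer [k], and each of the [j.+1 - k] activations from layer [k] to
    layer [j] raises it to the power [H]. *)
Lemma hidden_at_layer theta x k s j : (0 < k)%N -> 0 <= s ->
  hidden sigma (rescale (at_layer k s) theta) x j =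
  (if (j < k)%N then 1 else s `^ (H ^+ (j.+1 - k))) *: hidden sigma theta x j.
Proof.
move=> k0 s0; elim: j => [|j IH]; first by rewrite k0 scale1r.
rewrite /= IH W_rescale// -scalemxAl -scalemxAr scalerA sigma_hom; last first.
  by rewrite mulr_ge0// /at_layer; case: ifP => // _; rewrite powR_ge0.
congr (_ *: _); rewrite /at_layer; case: (ltngtP j.+1 k) => [jk|jk|jk].
- by rewrite mul1r powR1.
- rewrite mul1r -powRrM -exprSr.
  by rewrite (subSn (_ : (k <= j.+1)%N))// ltnW.
- by rewrite -jk mulr1 subSnn expr1.
Qed.

Lemma network_at_layer theta x k s : (0 < k <= K)%N -> 0 <= s ->
  network sigma x (rescale (at_layer k s) theta) =
  s `^ (H ^+ (K - k)) * network sigma x theta.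
Proof.
move=> /andP[k0 kK] s0.
rewrite /network w_last_rescale hidden_at_layer// fdotZl fdotC fdotZl fdotC.
rewrite mulrA prednK//; congr (_ * _).
(* The last layer has no activation: for [k = K] the factor [s] comes out linearly, in accordance
   with [H ^+ 0 = 1]. *)
rewrite /at_layer; case: (ltngtP K k) kK => // [kK|->] _.
- by rewrite mul1r.
- by rewrite mulr1 subnn expr0 powRr1.
Qed.

(** The bound is the product of the spectral norms with exponents [H ^+ (K - k)], written through
    logarithms so that it fits the AM-GM step; positivity makes each [ln] meaningful. *)
Lemma network_bound theta x : fnorm x <= 1 ->
  (forall k, (0 < k <= K)%N -> 0 < on_layer (@spectral_norm R) theta k) ->
  `|network sigma x theta| <=
  expR (\sum_(1 <= k < K.+1)
    H ^+ (K - k) * ln (on_layer (@spectral_norm R) theta k)).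
Proof.
move=> x1 spec_gt0.
have hid j : (j < K)%N -> fnorm (hidden sigma theta x j) <=
    expR (\sum_(1 <= k < j.+1)
      H ^+ (j.+1 - k) * ln (on_layer (@spectral_norm R) theta k)).
  elim: j => [_|j IH jK]; first by rewrite big_geq// expR0.
  have sj : 0 < on_layer (@spectral_norm R) theta j.+1.
    by rewrite spec_gt0//= ltnW.
  apply: le_trans (sigma_le _) _.
  rewrite big_nat_recr//= subSnn expr1.
  (* One more activation multiplies all earlier exponents by [H]. *)
  under eq_big_nat => k /andP[_ kj].
    rewrite ltnS in kj; rewrite (subSn (ltnW _))// exprS -mulrA.
  over.
  rewrite -mulr_sumr -mulrDr mulrC expRM.
  apply: ge0_ler_powR; rewrite ?nnegrE ?fnorm_ge0 ?expR_ge0//.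
  apply: le_trans (spectral_bound _ _ _ _) _.
  have -> : spectral_norm (W theta j.+1) =
      on_layer (@spectral_norm R) theta j.+1.
    by rewrite /on_layer jK.
  rewrite expRD lnK ?posrE// mulrC.
  by rewrite ler_pM2r//; apply: IH; exact: ltnW.
have -> : `|network sigma x theta| =
    fnorm ((w_last theta)^T *m hidden sigma theta x K.-1).
  rewrite -sqrtr_sqr /fnorm [in RHS]fdot_row big_ord1 -expr2.
  congr (Num.sqrt (_ ^+ 2)); rewrite mxE.
  by apply: eq_bigr => i _; rewrite big_ord1 !mxE.
apply: le_trans (spectral_bound _ _ _ _) _.
have -> : spectral_norm (w_last theta)^T = on_layer (@spectral_norm R) theta K.
  by rewrite /on_layer ltnn.
have sK : 0 < on_layer (@spectral_norm R) theta K by rewrite spec_gt0// K_gt0/=.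
rewrite big_nat_recr//= subnn expr0 mul1r expRD lnK ?posrE// mulrC ler_pM2r//.
have := hid K.-1; rewrite prednK//; exact.
Qed.

End Network.

(** * Derivatives, Clarke subgradients and weighted AM-GM *)

Section Analysis.
Context {R : realType}.

Lemma is_derive_line {N} (L : 'rV[R]_N -> R) (u P v : 'rV[R]_N) :
  is_gradient L u v ->
  is_derive (0 : R) (1 : R) (fun t => L (t *: P + u)) (fdot v P).
Proof.
move=> [dL dv].
pose f t := L (t *: P + u).
have E : (fun h : R => h^-1 *: ((f \o shift 0) (h *: (1 : R)) - f 0)) =
  (fun h : R => h^-1 *: ((L \o shift u) (h *: P) - L u)).
  by apply/funext => h; rewrite /f /= addr0 scale0r add0r [h *: 1]mulr1.
have D : derivable L u P by exact: diff_derivable.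
apply: DeriveDef; first by rewrite /derivable E.
by rewrite /derive E -dv -deriveE.
Qed.

Lemma is_derive_logistic_powR (z p : R) :
  is_derive (0 : R) (1 : R) (fun t => logistic ((1 + t) `^ p * z))
    (- p * (z / (1 + expR z))).
Proof.
have d1 : is_derive (0 : R) (1 : R) (fun t => 1 + t) 1.
  by rewrite -[X in is_derive _ _ _ X]add0r; apply: is_deriveD.
have d2 : is_derive (0 : R) (1 : R) (fun t => (1 + t) `^ p) p.
  have := @is_derive1_comp _ (fun t => t `^ p) _ 0 _ _
    (@is_derive1_powR _ p (1 + 0) _) d1.
  by rewrite addr0 powR1 !mulr1; apply; exact: ltr01.
have d3 : is_derive (0 : R) (1 : R) (fun t => (- z) *: (1 + t) `^ p) (- z *: p).
  exact: is_deriveZ.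
have d4 := @is_derive1_comp _ expR _ 0 _ _ (is_derive_expR _) d3.
have d5 : is_derive (0 : R) (1 : R) (fun t => 1 + expR (- z *: (1 + t) `^ p))
    (0 + expR (- z *: (1 + 0) `^ p) * (- z *: p)) by exact: is_deriveD.
have pos : 0 < 1 + expR (- z *: (1 + 0) `^ p) by rewrite ltr_pwDl// expR_ge0.
have := @is_derive1_comp _ (@ln R) _ 0 _ _ (is_derive1_ln pos) d5.
rewrite addr0 powR1 add0r.
have -> : @ln R \o (fun t => 1 + expR (- z *: (1 + t) `^ p)) =
  (fun t => logistic ((1 + t) `^ p * z)).
  by apply/funext => t; rewrite /logistic /= [in RHS]mulrC -mulNr.
have -> : - z *: (1 : R) = - z by exact: mulr1.
have -> : (1 + expR (- z))^-1 * (expR (- z) * (- z *: p)) =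
  - p * (z / (1 + expR z)).
  rewrite -[_ *: _]/(_ * _) expRN; field.
  by rewrite !gt_eqF ?ltr_pwDl ?expR_ge0 ?expR_gt0//.
by [].
Qed.

(** Induction principle given by minimality of the convex hull: only limits of gradients and convex
    combinations need checking. *)
Lemma clarke_ind {N} (F : 'rV[R]_N -> R) (A : set 'rV[R]_N) theta :
  (forall g h a, 0 <= a -> a <= 1 -> A g -> A h -> A (a *: g + (1 - a) *: h)) ->
  (forall u v g, u @ \oo --> theta ->
     (forall j : nat, is_gradient F (u j) (v j)) -> v @ \oo --> g -> A g) ->
  clarke F theta `<=` A.
Proof.
move=> Aconv Alim; apply: smallest_sub => [g h a|g [u [v [uth grad vg]]]].
  by rewrite !inE => Ag Ah; apply: (Aconv g h a%:num).
exact: (Alim _ _ _ uth grad vg).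
Qed.

Lemma locally_lipschitz_continuous {N} (F : 'rV[R]_N -> R) :
  locally_lipschitz F -> continuous F.
Proof.
move=> lipF theta; have [U thU /pinfty_ex_gt0[M M0 lip]] := lipF theta.
have thF : Filter (nbhs theta) by exact: nbhs_filter.
apply/(@cvgrPdist_lt _ _ _ (nbhs theta) thF) => e e0.
have eM : 0 < e / M by rewrite divr_gt0.
apply: (@filterS2 _ _ thF _ _ _ _ thU (nbhsx_ballx theta _ eM)) => t Ut.
rewrite -ball_normE /= => tM.
have := lip (theta, t) (conj (nbhs_singleton thU) Ut) => /= /le_lt_trans; apply.
by rewrite mulrC -ltr_pdivlMr.
Qed.

Lemma cvg_coord {N} (u : nat -> 'rV[R]_N) (a : 'rV[R]_N) i :
  u @ \oo --> a -> u j 0 i @[j --> \oo] --> a 0 i.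
Proof.
move=> ua.
apply: (@continuous_cvg _ _ _ _ _ u (fun A : 'rV[R]_N => A 0 i) a) ua.
exact: coord_continuous.
Qed.

(** With [g] the weighted mean of the [ln (t k)], the tangent of [expR] at [g] lies below it:
    [t k >= expR g * (1 + (ln (t k) - g))]. The deviations from [g] cancel in the weighted sum. *)
Lemma weighted_AMGM (a b : nat) (w t : nat -> R) :
  (forall k, (a <= k < b)%N -> 0 <= w k) ->
  (forall k, (a <= k < b)%N -> 0 < t k) ->
  \sum_(a <= k < b) w k = 1 ->
  expR (\sum_(a <= k < b) w k * ln (t k)) <= \sum_(a <= k < b) w k * t k.
Proof.
move=> w0 t0 w1; set g := \sum_(a <= k < b) _.
have -> : expR g = \sum_(a <= k < b) w k * (expR g * (1 + (ln (t k) - g))).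
  under eq_bigr => k _.
    rewrite (_ : _ * _ = expR g * (1 - g) * w k + expR g * (w k * ln (t k)));
      last by ring.
  over.
  by rewrite big_split /= -!mulr_sumr w1 -/g; ring.
rewrite big_nat_cond [leRHS]big_nat_cond; apply: ler_sum => k /andP[kab _].
rewrite ler_wpM2l ?w0// -[leRHS]lnK ?posrE ?t0//.
rewrite -{2}(addrNK g (ln (t k))) expRD mulrC.
by rewrite ler_pM2r ?expR_gt0// expR_ge1Dx.
Qed.

End Analysis.

(** * Derivative of the loss along one layer *)

Section LayerDerivative.
Context {R : realType} {K d m n : nat} (H : R) (sigma : 'cV[R]_m -> 'cV[R]_m).
Implicit Types theta : 'rV[R]_(nparams K d m).
Context (x : 'I_n -> 'cV[R]_d) (y : 'I_n -> R).
Context (K_gt0 : (0 < K)%N) (sigma_hom : pos_homogeneous H sigma).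

(** The logistic loss has derivative -1 / (1 + e^z), so this is the mean of minus z times the
    derivative of the loss at the margin z. *)
Definition margin_moment theta : R :=
  n%:R^-1 * \sum_i y i * network sigma (x i) theta /
    (1 + expR (y i * network sigma (x i) theta)).

(** The derivative at [t = 0] of the loss along [t *: P + theta] is computed twice: from the
    gradient, and from homogeneity. *)
Lemma gradient_layer theta v k : (0 < k <= K)%N ->
  is_gradient (loss sigma x y) theta v ->
  fdot v (rescale (only_layer k) theta) =
  - (H ^+ (K - k) * margin_moment theta).
Proof.
move=> kK grad; set P := rescale _ _.
have D1 := is_derive_line _ _ P _ grad.
pose z i := y i * network sigma (x i) theta; pose q := H ^+ (K - k).
have D2 : is_derive (0 : R) (1 : R)
    (n%:R^-1 *: \sum_(i < n) (fun t => logistic ((1 + t) `^ q * z i)))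
    (n%:R^-1 *: \sum_(i < n) (- q * (z i / (1 + expR (z i))))).
  apply: is_deriveZ; apply: is_derive_sum => i.
  exact: is_derive_logistic_powR.
set h := (X in is_derive _ _ X _) in D2.
(* Homogeneity needs [0 <= 1 + t], so the two functions are compared only near 0. *)
have eqL : \forall t \near (0 : R), loss sigma x y (t *: P + theta) = h t.
  near=> t.
  rewrite -rescale_at_layer /h /loss fctE fct_sumE.
  congr (_ * _); apply: eq_bigr => i _.
  rewrite (network_at_layer _ _ K_gt0 sigma_hom)//; first by rewrite mulrCA.
  rewrite -lerBlDl sub0r ltW//; near: t.
  by apply: lt_nbhsr; rewrite ltrN10.
rewrite -(@derive_val _ _ _ _ _ _ _ (near_eq_is_derive eqL D1)).
rewrite (@derive_val _ _ _ _ _ _ _ D2) -mulr_sumr /margin_moment.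
by rewrite [_ *: _]mulrCA mulNr.
Unshelve. all: by end_near.
Qed.

(** The left-hand side is linear in [g] and the right-hand side is free of [g], which settles convex
    combinations. In a limit the base point moves as well, hence the continuity of the network. *)
Lemma clarke_layer theta g k : (0 < k <= K)%N ->
  (forall z : 'cV[R]_d, continuous (network (K := K) sigma z)) ->
  clarke (loss sigma x y) theta g ->
  fdot g (rescale (only_layer k) theta) =
  - (H ^+ (K - k) * margin_moment theta).
Proof.
move=> kK cont; move: g.
apply: clarke_ind => [g h a a0 a1 /= Ag Ah|u v g uth grad vg].
  by rewrite fdotDl !fdotZl Ag Ah; ring.
have cfdot : fdot (v j) (rescale (only_layer k) (u j)) @[j --> \oo] -->
    fdot g (rescale (only_layer k) theta).
  under eq_fun do rewrite fdot_row; rewrite fdot_row.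
  apply: (@cvg_big _ _ _ _ _ (@add_continuous R)) => i _.
  apply: cvgM; first exact: cvg_coord.
  under eq_fun do rewrite mxE; rewrite mxE.
  by apply: cvgM; [exact: cvg_cst|exact: cvg_coord].
have cS : - (H ^+ (K - k) * margin_moment (u j)) @[j --> \oo] -->
    - (H ^+ (K - k) * margin_moment theta).
  apply: cvgN; apply: cvgM; first exact: cvg_cst.
  apply: cvgM; first exact: cvg_cst.
  apply: (@cvg_big _ _ _ _ _ (@add_continuous R)) => i _.
  have cz : y i * network sigma (x i) (u j) @[j --> \oo] -->
      y i * network sigma (x i) theta.
    apply: cvgM; first exact: cvg_cst.
    exact: (@continuous_cvg _ _ _ _ _ u (network sigma (x i)) theta
      (cont (x i) theta) uth).
  apply: cvgM => //; apply: cvgV; first by rewrite gt_eqF// ltr_pwDl// expR_ge0.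
  apply: cvgD; first exact: cvg_cst.
  apply: (@continuous_cvg _ _ _ _ _ _ (@expR R) _ _ cz).
  exact: continuous_expR.
have fE : (fun j => fdot (v j) (rescale (only_layer k) (u j))) =
    (fun j => - (H ^+ (K - k) * margin_moment (u j))).
  by apply/funext => j; exact: gradient_layer.
rewrite fE in cfdot.
exact: (cvg_unique _ cfdot cS).
Qed.
End LayerDerivative.

(** * Norms of the layers, and bounds on the loss and the margin moment *)

Section Bounds.
Context {R : realType} {K d m n : nat}.
Implicit Types theta : 'rV[R]_(nparams K d m).

Lemma layer_sqr_fnorm_sum theta : (0 < K)%N ->
  fnorm theta ^+ 2 = \sum_(1 <= k < K.+1) on_layer (@fnorm R) theta k ^+ 2.
Proof.
move=> K0; rewrite sqr_fnorm -{2}(rescale1 theta) fdot_rescale//.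
by apply: eq_bigr => k _; rewrite mul1r.
Qed.

Lemma fdot_only_layer theta k : (0 < k <= K)%N ->
  fdot theta (rescale (only_layer k) theta) = on_layer (@fnorm R) theta k ^+ 2.
Proof.
move=> /andP[k0 kK]; rewrite fdot_rescale ?(leq_trans k0)//.
rewrite (bigD1_seq k) ?iota_uniq ?mem_index_iota ?k0//= /only_layer eqxx mul1r.
by rewrite big1 ?addr0// => j /negbTE ->; rewrite mul0r.
Qed.

Lemma on_layer_spectral_gt0 theta k :
  0 < on_layer (@fnorm R) theta k -> 0 < on_layer (@spectral_norm R) theta k.
Proof.
by rewrite /on_layer; case: ifP => _ n0; apply: spectral_norm_gt0;
  rewrite -fnorm_gt0.
Qed.

Lemma on_layer_fnorm_ge0 theta k : 0 <= on_layer (@fnorm R) theta k.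
Proof. by rewrite /on_layer; case: ifP => _; exact: fnorm_ge0. Qed.

Lemma loss_ge0 sigma (x : 'I_n -> 'cV[R]_d) (y : 'I_n -> R) theta :
  0 <= loss sigma x y theta.
Proof.
rewrite mulr_ge0 ?invr_ge0 ?ler0n//; apply: sumr_ge0 => i _.
by rewrite ln_ge0// lerDl expR_ge0.
Qed.

Lemma margin_moment_le sigma (x : 'I_n -> 'cV[R]_d) (y : 'I_n -> R) theta M :
  0 <= M -> (forall i, y i = -1 \/ y i = 1) ->
  (forall i, `|network sigma (x i) theta| <= M) ->
  margin_moment sigma x y theta <= M.
Proof.
move=> M0 y1 fM; rewrite /margin_moment.
(* An empty sample gives moment 0, by the convention [0^-1 = 0]. *)
have [n0|n0] := posnP n.
  by have -> : n%:R^-1 = 0 :> R by [rewrite n0 invr0]; rewrite mul0r.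
rewrite mulrC ler_pdivrMr ?ltr0n//.
apply: (@le_trans _ _ (\sum_(i < n) M)); last first.
  by rewrite sumr_const card_ord mulr_natr.
(* Each term is at most its numerator in absolute value, since the denominator is at least 1. *)
apply: ler_sum => i _.
have e0 : 0 < 1 + expR (y i * network sigma (x i) theta).
  by rewrite ltr_pwDl// expR_ge0.
rewrite ler_pdivrMr//.
apply: (@le_trans _ _ M); last by rewrite ler_peMr// lerDl expR_ge0.
apply: le_trans (ler_norm _) _; rewrite normrM.
by have [->|->] := y1 i; rewrite ?normrN1 ?normr1 mul1r.
Qed.
End Bounds.

(** * From balanced layers to the bound on the norm ratios *)

Theorem corollary1 (R : realType) (K d m n : nat) (H : R)
    (sigma : 'cV[R]_m -> 'cV[R]_m)
    (x : 'I_n -> 'cV[R]_d) (y : 'I_n -> R) (lambda : R)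
    (theta theta0 : 'rV[R]_(nparams K d m)) :
  (2 <= K)%N ->
  1 <= H ->
  (forall i, fnorm (x i) <= 1) ->
  (forall i, y i = -1 \/ y i = 1) ->
  pos_homogeneous H sigma ->
  (forall v : 'cV[R]_m, fnorm (sigma v) <= fnorm v `^ H) ->
  (forall z : 'cV[R]_d,
     locally_lipschitz (network (K := K) sigma z)) ->
  (forall z : 'cV[R]_d, chain_rule (network (K := K) sigma z)) ->
  chain_rule (loss (K := K) sigma x y) ->
  0 < lambda ->
  theta != 0 ->
  stationary lambda (loss sigma x y) theta ->
  regularized lambda (loss sigma x y) theta
    <= regularized lambda (loss sigma x y) theta0 ->
  1 <= loss sigma x y theta0 ->
  let Z : R := \sum_(1 <= k < K.+1) H ^+ (K - k) in
  \sum_(1 <= k < K.+1)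
      (H ^+ (K - k)) `^ (3 / 2) / Z *
      (on_layer (@spectral_norm R) theta k / on_layer (@fnorm R) theta k)
    >= Num.sqrt (lambda / (loss sigma x y theta0 + lambda * fnorm theta0 ^+ 2)).
Proof.
move=> K2 H1 x1 y1 sigma_hom sigma_le lip _ _ lambda0 theta_neq0.
move=> [g clg lg] Lle L01.
cbv zeta; set Z := \sum_(1 <= k < K.+1) H ^+ (K - k).
have K0 : (0 < K)%N by exact: ltnW.
have H0 : 0 <= H by exact: le_trans H1.
pose p k := H ^+ (K - k).
pose N k := on_layer (@fnorm R) theta k.
pose s k := on_layer (@spectral_norm R) theta k.
set S := margin_moment sigma x y theta.
have p1 k : 1 <= p k by exact: exprn_ege1.
have p0 k : 0 < p k by exact: lt_le_trans (p1 k).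
have NS k : (1 <= k < K.+1)%N -> lambda * N k ^+ 2 = p k * S.
  move=> kK.
  have cont z := locally_lipschitz_continuous _ (lip z).
  have := clarke_layer _ _ x y K0 sigma_hom theta g k kK cont clg.
  have -> : g = - lambda *: theta by rewrite scaleNr lg opprK.
  by rewrite fdotZl mulNr fdot_only_layer// => /oppr_inj.
have ZE : Z = \sum_(1 <= k < K.+1) p k by [].
have Z2 : 2 <= Z.
  apply: (@le_trans _ _ (\sum_(1 <= k < K.+1) 1)).
    by rewrite sumr_const_nat subn1 ler_nat.
  by rewrite ZE; apply: ler_sum => k _; exact: p1.
have Z0 : 0 < Z by exact: lt_le_trans Z2.
have normS : lambda * fnorm theta ^+ 2 = Z * S.
  rewrite layer_sqr_fnorm_sum// mulr_sumr ZE mulr_suml.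
  by apply: eq_big_nat => k kK; exact: NS.
(* As [theta] is nonzero, [S] is positive; then every layer is nonzero, and all later divisions and
   logarithms are proper. *)
have S0 : 0 < S.
  rewrite -(pmulr_rgt0 _ Z0) -normS mulr_gt0// exprn_gt0//.
  by rewrite fnorm_gt0.
pose c := S / lambda.
have c0 : 0 < c by rewrite divr_gt0.
have NE k : (1 <= k < K.+1)%N -> N k = Num.sqrt (p k) * Num.sqrt c.
  move=> kK; rewrite -sqrtrM ?ltW// mulrA -NS// mulrAC divff ?gt_eqF// mul1r.
  by rewrite sqrtr_sqr ger0_norm ?on_layer_fnorm_ge0.
have s0 k : (1 <= k < K.+1)%N -> 0 < s k.
  move=> kK; apply: on_layer_spectral_gt0; rewrite -/(N k) NE//.
  by rewrite mulr_gt0 ?sqrtr_gt0.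
pose E := \sum_(1 <= k < K.+1) p k * ln (s k).
have SE : S <= expR E.
  apply: margin_moment_le (expR_ge0 _) y1 _ => i.
  exact: (network_bound _ _ K0 H0 sigma_le).
pose a k := s k / Num.sqrt c.
have a0 k : (1 <= k < K.+1)%N -> 0 < a k.
  by move=> kK; rewrite divr_gt0 ?s0// sqrtr_gt0.
(* The exponent 3/2 is chosen so that the factor [Num.sqrt (p k)] of [N k] cancels, leaving weights
   [p k / Z] of sum 1. *)
have -> : \sum_(1 <= k < K.+1) p k `^ (3 / 2) / Z * (s k / N k) =
    \sum_(1 <= k < K.+1) p k / Z * a k.
  apply: eq_big_nat => k kK; rewrite NE// (_ : 3 / 2 = 1 + 2^-1); last by lra.
  rewrite powRD; last by rewrite implybE gt_eqF// orbT.
  rewrite powRr1 ?ltW// powR12_sqrt ?ltW// /a.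
  by field; rewrite !gt_eqF ?sqrtr_gt0.
have w1 : \sum_(1 <= k < K.+1) p k / Z = 1.
  by rewrite -mulr_suml -ZE divff// gt_eqF.
apply: le_trans (weighted_AMGM 1 K.+1 _ a _ a0 w1); last first.
  by move=> k _; rewrite divr_ge0 ?ltW.
have -> : \sum_(1 <= k < K.+1) p k / Z * ln (a k) = E / Z - ln (Num.sqrt c).
  rewrite -[ln (Num.sqrt c)]mul1r -w1 /E !mulr_suml -sumrB.
  apply: eq_big_nat => k kK; rewrite /a ln_div ?posrE ?s0 ?sqrtr_gt0//.
  by ring.
rewrite expRB lnK ?posrE ?sqrtr_gt0//.
rewrite -[expR _]ger0_norm ?expR_ge0// -sqrtr_sqr.
rewrite -(sqrtrV (ltW c0)) -sqrtrM ?sqr_ge0//.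
set T := fnorm theta0 ^+ 2; set L0 := loss sigma x y theta0.
have T0 : 0 <= T by exact: sqr_ge0.
have lT : 0 <= lambda * T by rewrite mulr_ge0// ltW.
have Q0 : 0 < L0 + lambda * T by rewrite ltr_pwDl// (lt_le_trans ltr01).
rewrite ler_wsqrtr// /c invf_div.
have -> : expR (E / Z) ^+ 2 * (lambda / S) = lambda * (expR (E / Z) ^+ 2 / S).
  by rewrite mulrCA.
rewrite ler_pM2l// -[leRHS]invf_div.
rewrite lef_pV2 ?posrE ?divr_gt0 ?exprn_gt0 ?expR_gt0//.
rewrite ler_pdivrMr ?exprn_gt0 ?expR_gt0// mulrC.
rewrite -expRM_natl.
(* What remains is [S <= expR (2 * (E / Z)) * (L0 + lambda * T)], where [expR E] is the product
   P. *)
have [E0|E0] := leP 0 E.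
  (* Here [2 * S <= Z * S = lambda * fnorm theta ^+ 2], which is at most [2 * L0 + lambda * T]
     because the loss at [theta] is nonnegative. *)
  have SQ : S <= L0 + lambda * T.
    have := Lle; rewrite /regularized -/T -/L0.
    have := loss_ge0 sigma x y theta.
    have : 2 * S <= Z * S by rewrite ler_pM2r.
    rewrite -normS; lra.
  apply: le_trans SQ _; rewrite ler_peMl ?(ltW Q0)// -expR0 ler_expR.
  by rewrite mulr_ge0 ?divr_ge0 ?(ltW Z0).
(* For [E < 0], the bound [2 <= Z] gives [E <= 2 * (E / Z)]. *)
apply: (le_trans SE); apply: (@le_trans _ _ (expR (2 * (E / Z)))).
  rewrite ler_expR mulrA ler_pdivlMr//.
  by rewrite mulrC ler_wnM2r// ltW.
by rewrite ler_peMr ?expR_ge0// (le_trans L01)// lerDl.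
Qed.
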